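(* For every graph $F$ of diameter $2$, there exist infinitely many pairwise non-isomorphic graphs $G$ of diameter $3$ that are $F$-irregular.
   Context: All graphs are simple, finite, undirected and non-trivial. For graphs $F$ and $G$ and a vertex $v$ of $G$, the $F$-degree of $v$ in $G$ is the number of subgraphs of $G$ (not necessarily induced) that are isomorphic to $F$ and contain $v$. A graph $G$ is $F$-irregular if any two distinct vertices of $G$ have different $F$-degrees. *)

(* Defs.v *)
From mathcomp Require Import all_boot.
Set Implicit Arguments. Unset Strict Implicit. Unset Printing Implicit Defensive.

Record sgraph := SGraph {
  vert : finType;
  adj : rel vert;
  adj_sym : symmetric adj;
  adj_irr : irreflexive adj }.

Definition nontrivial (G : sgraph) : Prop := 1 < #|vert G|.

Definition within (G : sgraph) (k : nat) (u v : vert G) : Prop :=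
  exists p : seq (vert G), [&& path (@adj G) u p, last u p == v & size p <= k].

Definition has_diameter (G : sgraph) (d : nat) : Prop :=
  0 < d /\ (forall u v : vert G, within d u v) /\
  exists u v : vert G, ~ within d.-1 u v.

Definition isomorphic (G H : sgraph) : Prop :=
  exists f : vert G -> vert H, bijective f /\
    forall x y, adj (f x) (f y) = adj x y.

(* A subgraph of G (not necessarily induced) is a pair (S, E) with S a vertex
   set and E a symmetric set of ordered pairs encoding edges of G between
   vertices of S. *)
Definition is_subgraph (G : sgraph) (p : {set vert G} * {set (vert G * vert G)}) : bool :=
  [forall xy in p.2,
     [&& adj xy.1 xy.2, xy.1 \in p.1, xy.2 \in p.1 & (xy.2, xy.1) \in p.2]].

Definition subgraph_iso (F G : sgraph) (p : {set vert G} * {set (vert G * vert G)}) : bool :=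
  [exists f : {ffun vert F -> vert G},
     [&& injectiveb f, f @: setT == p.1 &
         [forall x, forall y, ((f x, f y) \in p.2) == adj x y]]].

Definition Fdeg (F G : sgraph) (v : vert G) : nat :=
  #|[set p : {set vert G} * {set (vert G * vert G)} |
       [&& is_subgraph p, subgraph_iso F p & v \in p.1]]|.

Definition F_irregular (F G : sgraph) : Prop := injective (@Fdeg F G).

(* Main.v *)
Require Import Defs.
From mathcomp Require Import all_boot.
From mathcomp Require Import perm zify.

Set Implicit Arguments. Unset Strict Implicit. Unset Printing Implicit Defensive.

(* Let m = #|F|.  Take two cliques x_0, ..., x_n and y_0, ..., y_n with x_i ~ y_j
   iff i + j > n, and a vertex t adjacent to x_0, ..., x_(m-1), with n huge
   compared to m.  It suffices to compare numbers of labelled embeddings of F,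
   which are the F-degrees times #|Aut F|.
   Without t the graph is symmetric under x_i <-> y_i; let D_i be the number of
   embeddings avoiding t through x_i, or equivalently through y_i.  Since
   N(x_i) is nested in N(x_(i+1)), exchanging the two vertices gives D_i < D_(i+1),
   and the embeddings using the edge x_(i+1) y_(n-i) make the difference larger
   than the number A_i of embeddings through t and x_i.  Both are of order
   n^(m-2) only when t plays a leaf of F whose neighbour goes to x_i; those
   embeddings are injected explicitly into the difference.
   As F has diameter 2, an embedding through t meets only x's and the m - 1 last
   y's, whence the number B_i of embeddings through t and y_i is less than A_i.
   So the counts D_i + B_i < D_i + A_i < D_(i+1) + B_(i+1) are distinct, and the
   count at t, of lower order, is smaller than D_0. *)

(** * Counting finite functions *)

Lemma card_le_cover (I T : finType) (A : {set T}) (C : I -> {set T}) (K : nat) :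
  (forall x, x \in A -> exists i, x \in C i) -> (forall i, #|C i| <= K) ->
  #|A| <= #|I| * K.
Proof.
move=> covA leK; apply: leq_trans (_ : #|\bigcup_i C i| <= _).
  by apply/subset_leq_card/subsetP=> x /covA [i xi]; apply/bigcupP; exists i.
rewrite -sum_nat_const; elim/big_rec2: _ => [|i s B _ leB]; first by rewrite cards0.
by rewrite (leq_trans (leq_card_setU _ _)) // leq_add.
Qed.

Lemma card_ffun_fixed (aT rT : finType) (D : {set aT}) (p : aT -> rT) :
  #|[set f : {ffun aT -> rT} | [forall e in D, f e == p e]]| = #|rT| ^ #|~: D|.
Proof.
pose P (e : aT) : pred rT := if e \in D then pred1 (p e) else predT.
have -> : #|[set f : {ffun aT -> rT} | [forall e in D, f e == p e]]| = #|family P|.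
  apply: eq_card => f; rewrite inE; apply/forall_inP/familyP => fP e.
    by rewrite /P; case: ifP => // eD; rewrite inE fP.
  by move=> eD; have := fP e; rewrite /P eD inE.
rewrite card_family foldrE big_map big_enum /= -prod_nat_const [RHS]big_mkcond /=.
apply: eq_bigr => e _; rewrite /P inE; case: (e \in D) => /=; last exact: eq_card.
exact: card1.
Qed.

Definition post (S T U : finType) (h : T -> U) (f : {ffun S -> T}) : {ffun S -> U} :=
  [ffun e => h (f e)].

Lemma post_inj (S T U : finType) (h : T -> U) :
  injective h -> injective (@post S T U h).
Proof.
move=> hI f g /ffunP fg; apply/ffunP=> e; apply: hI.
by have := fg e; rewrite !ffunE.
Qed.

Lemma codom_post (S T : finType) (h : T -> T) (f : {ffun S -> T}) x :
  injective h -> (h x \in codom (post h f)) = (x \in codom f).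
Proof.
move=> hI; apply/codomP/codomP => -[e].
  by rewrite ffunE => /hI ->; exists e.
by move=> ->; exists e; rewrite ffunE.
Qed.

Lemma card_le_post (S T U : finType) (h : T -> U)
    (A : {set {ffun S -> T}}) (B : {set {ffun S -> U}}) :
  injective h -> (forall f, f \in A -> post h f \in B) -> #|A| <= #|B|.
Proof.
move=> hI AB; rewrite -(card_imset _ (post_inj (S := S) hI)).
by apply/subset_leq_card/subsetP => _ /imsetP [f fA ->]; apply: AB.
Qed.

Definition through (S T : finType) (A : {set {ffun S -> T}}) (x : T) :=
  [set f in A | x \in codom f].

Lemma in_through (S T : finType) (A : {set {ffun S -> T}}) (x : T) f :
  (f \in through A x) = (f \in A) && (x \in codom f).
Proof. by rewrite inE. Qed.

(* Send [f] to [tperm x x' \o f] when [f] avoids [x'] and to itself otherwise: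
   this injects [through A x] into [through A x'] and misses [Q]. *)
Lemma card_through_swap (S T : finType) (A Q : {set {ffun S -> T}}) (x x' : T) :
  (forall f, f \in A -> x \in codom f -> x' \notin codom f ->
     post (tperm x x') f \in A) ->
  (forall f, f \in Q -> [/\ f \in A, x' \in codom f, x \notin codom f &
     post (tperm x x') f \notin A]) ->
  #|through A x| + #|Q| <= #|through A x'|.
Proof.
move=> swA QP.
pose th (f : {ffun S -> T}) := if x' \in codom f then f else post (tperm x x') f.
have tI : injective (tperm x x') by apply: perm_inj.
have tK (f : {ffun S -> T}) : post (tperm x x') (post (tperm x x') f) = f.
  by apply/ffunP=> e; rewrite !ffunE tpermK.
have tx' (f : {ffun S -> T}) :
    (x' \in codom (post (tperm x x') f)) = (x \in codom f).
  by rewrite -{1}(tpermL x x') codom_post.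
have tx (f : {ffun S -> T}) :
    (x \in codom (post (tperm x x') f)) = (x' \in codom f).
  by rewrite -{1}(tpermR x x') codom_post.
have thI : {in through A x &, injective th}.
  move=> f g; rewrite !inE /th => /andP [_ fx] /andP [_ gx].
  case: ifP => fx'; case: ifP => gx' // E.
  - by move: fx; rewrite E tx gx'.
  - by move: gx; rewrite -E tx fx'.
  - exact: (post_inj tI E).
rewrite -(card_in_imset thI) -cardsUI.
(* A member of [Q] avoids [x] and leaves [A] when swapped, whereas [th f] either still contains [x]
   or swaps back to [f], which lies in [A]. *)
set W := _ :&: _; have -> : W = set0.
  apply/setP=> g; rewrite !inE; apply/negbTE/negP => /andP [/imsetP [f]].
  rewrite inE /th => /andP [fA fx]; case: ifP => fx' -> /QP [_ _].
    by rewrite fx.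
  by rewrite tK fA.
rewrite cards0 addn0; apply/subset_leq_card/subsetP => g; rewrite !inE.
case/orP => [/imsetP [f]|/QP [-> -> //]].
rewrite inE /th => /andP [fA fx] ->; case: ifP => fx'; first by rewrite fA.
by rewrite swA ?fx' // tx'.
Qed.

(* Roles [e] with [p e = Some z] are nailed to [z]; every other role gets its
   own block of [B.+1] consecutive values of [base], which forces injectivity. *)
Definition place (S T : finType) (p : S -> option T) (base : nat -> T) (B : nat)
    (g : {ffun S -> 'I_B.+1}) : {ffun S -> T} :=
  [ffun e => odflt (base (enum_rank e * B.+1 + g e)) (p e)].

Lemma block_lt (S : finType) (B : nat) (e : S) (i : 'I_B.+1) :
  enum_rank e * B.+1 + i < #|S| * B.+1.
Proof.
apply: leq_trans (_ : (enum_rank e).+1 * B.+1 <= _); last by rewrite leq_mul2r ltn_ord.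
by rewrite mulSn addnC ltn_add2r.
Qed.

Lemma block_inj (S : finType) (B : nat) (e e' : S) (i i' : 'I_B.+1) :
  enum_rank e * B.+1 + i = enum_rank e' * B.+1 + i' -> e = e' /\ i = i'.
Proof.
(* Division by [B.+1] recovers the block as quotient and the offset as remainder. *)
move=> E; have := congr1 (divn^~ B.+1) E; have := congr1 (modn^~ B.+1) E.
rewrite /= !modnMDl !divnMDl // !modn_small // !divn_small // !addn0.
by move=> /val_inj -> /val_inj /enum_rank_inj ->.
Qed.

Lemma card_place (S T : finType) (p : S -> option T) (base : nat -> T) (B : nat)
    (Q : {set {ffun S -> T}}) :
  (forall k l, k < #|S| * B.+1 -> l < #|S| * B.+1 -> base k = base l -> k = l) ->
  (forall g : {ffun S -> 'I_B.+1}, place p base g \in Q) ->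
  B.+1 ^ #|[set e | ~~ p e]| <= #|Q|.
Proof.
move=> baseI placeQ; rewrite -[in B.+1 ^ _](card_ord B.+1).
(* The values of [g] on nailed roles are lost by [place], so only those [g] that are [ord0] there
   are counted; on them [place] is injective. *)
rewrite -(card_pffun_on ord0 [set e | ~~ p e] predT).
rewrite -(card_in_imset (f := @place S T p base B)); last first.
  move=> f g /pffun_onP [/supportP f0 _] /pffun_onP [/supportP g0 _] /ffunP fg.
  apply/ffunP=> e; case: (boolP (e \in [set e | ~~ p e])) => [|ne]; last first.
    by rewrite f0 ?g0.
  rewrite inE; have := fg e; rewrite !ffunE; case: (p e) => //= /baseI E _.
  by case: (block_inj (E (block_lt _ _) (block_lt _ _))).
by apply/subset_leq_card/subsetP => _ /imsetP [g _ ->].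
Qed.

(** * Embeddings and F-degrees *)

Definition embeddings (F G : sgraph) : {set {ffun vert F -> vert G}} :=
  [set f : {ffun vert F -> vert G} |
     injectiveb f && [forall x, forall y, adj x y ==> adj (f x) (f y)]].

Lemma embeddingsP (F G : sgraph) (f : {ffun vert F -> vert G}) :
  reflect (injective f /\ forall x y, adj x y -> adj (f x) (f y))
          (f \in embeddings F G).
Proof.
rewrite inE; apply: (iffP andP) => [[/injectiveP fI /forallP fE]|[fI fE]].
  by split=> // x y; have /forallP/(_ y)/implyP := fE x.
split; first exact/injectiveP.
by apply/forallP=> x; apply/forallP=> y; apply/implyP/fE.
Qed.

(** The condition under the existential of [subgraph_iso], isolated so that its witnesses can be
    counted. *)
Definition iso_onto (F G : sgraph) (p : {set vert G} * {set (vert G * vert G)})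
    (f : {ffun vert F -> vert G}) : bool :=
  [&& injectiveb f, f @: setT == p.1 &
      [forall x, forall y, ((f x, f y) \in p.2) == adj x y]].

Lemma iso_ontoP (F G : sgraph)
    (p : {set vert G} * {set (vert G * vert G)}) (f : {ffun vert F -> vert G}) :
  reflect [/\ injective f, p.1 = f @: setT & forall x y, ((f x, f y) \in p.2) = adj x y]
          (iso_onto p f).
Proof.
apply: (iffP and3P) => [[/injectiveP fI /eqP <- /forallP fE]|[fI <- fE]].
  by split=> // x y; have /forallP/(_ y)/eqP := fE x.
split=> //; first exact/injectiveP.
by apply/forallP=> x; apply/forallP=> y; apply/eqP/fE.
Qed.

Definition automorphisms (F : sgraph) : {set {ffun vert F -> vert F}} :=
  [set a : {ffun vert F -> vert F} |
     injectiveb a && [forall x, forall y, adj (a x) (a y) == adj x y]].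

(** Once one isomorphism [f0] onto [p] is fixed, the others are exactly [f0] composed with the
    automorphisms of [F]. *)
Lemma card_iso_onto (F G : sgraph) (p : {set vert G} * {set (vert G * vert G)}) :
  subgraph_iso F p -> #|[set f | @iso_onto F G p f]| = #|automorphisms F|.
Proof.
case/existsP=> f0 /iso_ontoP [f0I p1E f0E].
have pI : injective (@post (vert F) _ _ f0) by apply: post_inj.
rewrite -(card_imset _ pI); apply: eq_card => f; rewrite inE.
apply/iso_ontoP/imsetP => [[fI p1E' fE]|[a]].
  have inv x : exists y, f x == f0 y.
    have: f x \in p.1 by rewrite p1E' imset_f.
    by rewrite p1E => /imsetP [y _ ->]; exists y.
  exists [ffun x => xchoose (inv x)].
    have aE x : f0 (xchoose (inv x)) = f x by rewrite -(eqP (xchooseP (inv x))).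
    rewrite inE; apply/andP; split.
      by apply/injectiveP=> x y; rewrite !ffunE => E; apply: fI; rewrite -!aE E.
    apply/forallP=> x; apply/forallP=> y; rewrite !ffunE -f0E !aE fE.
    exact: eqxx.
  by apply/ffunP=> x; rewrite !ffunE -(eqP (xchooseP (inv x))).
rewrite inE => /andP [/injectiveP aI /forallP aE] ->.
split=> [x y||x y].
- by rewrite !ffunE => /f0I /aI.
- rewrite p1E; apply/setP=> z; apply/imsetP/imsetP => -[x _ ->].
    exists (invF aI x); rewrite ?inE // ffunE f_invF //.
  by exists (a x); rewrite ?inE // ffunE.
- by rewrite !ffunE f0E; have /forallP/(_ y)/eqP := aE x.
Qed.

Definition subgraph_of (F G : sgraph) (f : {ffun vert F -> vert G}) :
    {set vert G} * {set (vert G * vert G)} :=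
  (f @: setT, [set (f e.1, f e.2) | e in [set e | adj e.1 e.2]]).

(** Identifies the isomorphisms onto [p] with the fibre of [subgraph_of] over [p]. Since edges of
    [p] have both ends in [p.1], each is the image of a pair of roles. *)
Lemma iso_onto_subgraph_of (F G : sgraph)
    (p : {set vert G} * {set (vert G * vert G)}) (f : {ffun vert F -> vert G}) :
  is_subgraph p -> iso_onto p f = (f \in embeddings F G) && (subgraph_of f == p).
Proof.
case: p => S E /forallP sub; apply/iso_ontoP/andP => /= [[fI SE fE]|].
  split.
    apply/embeddingsP; split=> // x y; rewrite -fE => xyE.
    by have := sub (f x, f y); rewrite xyE /= => /andP [].
  rewrite /subgraph_of xpair_eqE SE eqxx /=; apply/eqP/setP=> -[z1 z2].
  apply/imsetP/idP => [[[x y]]|zE]; first by rewrite inE /= -fE => ? [-> ->].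
  have := sub (z1, z2); rewrite zE /= SE => /and4P [_].
  move=> /imsetP [x _ z1E] /imsetP [y _ z2E] _; exists (x, y); last by rewrite z1E z2E.
  by rewrite inE /= -fE -z1E -z2E.
move=> [/embeddingsP [fI fE] /eqP [<- <-]]; split=> // x y.
apply/imsetP/idP => [[[a b]]|xy]; first by rewrite inE /= => ab [/fI -> /fI ->].
by exists (x, y); rewrite ?inE.
Qed.

Lemma subgraph_of_is_subgraph (F G : sgraph) (f : {ffun vert F -> vert G}) :
  f \in embeddings F G -> is_subgraph (subgraph_of f).
Proof.
move=> /embeddingsP [fI fE]; apply/forallP=> z; apply/implyP => /imsetP [[x y]].
rewrite inE /= => xy -> /=; rewrite fE ?imset_f //=.
by apply/imsetP; exists (y, x); rewrite ?inE //= adj_sym.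
Qed.

(** Group the embeddings by their image: whether [v] is met depends on the image only, and every
    fibre has as many elements as [F] has automorphisms. *)
Lemma card_through_embeddings (F G : sgraph) (v : vert G) :
  #|through (embeddings F G) v| = Fdeg F v * #|automorphisms F|.
Proof.
rewrite -sum1_card (partition_big (@subgraph_of F G)
  (fun p => [&& is_subgraph p, subgraph_iso F p & v \in p.1])) /=; last first.
  move=> f; rewrite inE => /andP [fE fv]; have sub := subgraph_of_is_subgraph fE.
  rewrite sub /=; apply/andP; split.
    by apply/existsP; exists f; have := iso_onto_subgraph_of f sub; rewrite fE eqxx.
  by case/codomP: fv => e ->; rewrite imset_f.
rewrite /Fdeg -sum1_card big_distrl /=; apply: eq_big => [p|p /and3P [sub iso pv]].
  by rewrite inE.
rewrite mul1n -(card_iso_onto iso) sum1_card; apply: eq_card => f.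
rewrite !inE iso_onto_subgraph_of // -topredE /= inE andbAC.
case: eqP => [fp|]; rewrite ?andbF // andbT.
suff -> : v \in codom f by rewrite andbT.
by move: pv; rewrite -fp => /imsetP [e _ ->]; apply: codom_f.
Qed.

Lemma F_irregular_embeddings (F G : sgraph) :
  injective (fun v => #|through (embeddings F G) v|) -> F_irregular F G.
Proof. by move=> cI u v E; apply: cI; rewrite /= !card_through_embeddings E. Qed.

(** * The twin graph *)

Lemma within_refl (G : sgraph) k (u : vert G) : within k u u.
Proof. by exists [::]; rewrite /= eqxx. Qed.

Lemma within_step (G : sgraph) k (u w v : vert G) :
  u = w \/ adj u w -> within k w v -> within k.+1 u v.
Proof.
case=> [->|uw] [p /and3P [pP pL pS]]; [exists p | exists (w :: p)].
  by rewrite pP pL (leq_trans pS).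
by rewrite /= uw pP pL ltnS pS.
Qed.

Lemma within1P (G : sgraph) (u v : vert G) : within 1 u v <-> u = v \/ adj u v.
Proof.
split=> [[[|w [|w' p]] /and3P []]|uv].
- by move=> _ /eqP; left.
- by rewrite /= andbT => uw /eqP <- _; right.
- by move=> /= _ _.
- exact: within_step uv (within_refl _ _).
Qed.

Lemma within2P (G : sgraph) (u v : vert G) :
  within 2 u v -> [\/ u = v, adj u v | exists2 w, adj u w & adj w v].
Proof.
case=> [[|w [|w' [|w'' p]]] /and3P []].
- by move=> _ /eqP; constructor 1.
- by rewrite /= andbT => uw /eqP <- _; constructor 2.
- by rewrite /= andbT => /andP [uw ww'] /eqP <- _; constructor 3; exists w.
- by move=> /= _ _.
Qed.

Lemma diameter2_cherry (F : sgraph) : has_diameter F 2 ->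
  exists v u w : vert F, [/\ v != w, ~~ adj v w, adj v u & adj u w].
Proof.
case=> _ [w2 [v [w nvw]]]; have vw : v != w.
  by apply/eqP => E; apply/nvw/within1P; left.
have nadj : ~~ adj v w by apply/negP => E; apply/nvw/within1P; right.
case: (within2P (w2 v w)) => [/eqP E|E|[u vu uw]].
- by rewrite E in vw.
- by rewrite E in nadj.
- by exists v, u, w.
Qed.

Lemma adj_neq (G : sgraph) (u v : vert G) : adj u v -> u != v.
Proof. by apply: contraTneq => ->; rewrite adj_irr. Qed.

(* Two cliques [Some (false, i)] and [Some (true, i)] of size [n.+1] (written
   x_i and y_i below) joined by x_i ~ y_j iff i + j > n, and one more vertex
   t = [None] adjacent to x_0, ..., x_(m-1). *)
Definition twin_adj (m n : nat) (z z' : option (bool * 'I_n.+1)) : bool :=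
  match z, z' with
  | None, None => false
  | None, Some (b, i) | Some (b, i), None => ~~ b && (i < m)
  | Some (b, i), Some (c, j) => if b == c then i != j else n < i + j
  end.

Lemma twin_adj_sym m n : symmetric (@twin_adj m n).
Proof.
by case=> [[b i]|] [[c j]|] //=; rewrite [c == b]eq_sym [j == i]eq_sym [j + i]addnC.
Qed.

Lemma twin_adj_irr m n : irreflexive (@twin_adj m n).
Proof. by case=> [[b i]|] //=; rewrite !eqxx. Qed.

Definition twin_graph (m n : nat) : sgraph :=
  SGraph (@twin_adj_sym m n) (@twin_adj_irr m n).

Lemma card_twin_graph m n : #|vert (twin_graph m n)| = (2 * n.+1).+1.
Proof. by rewrite card_option card_prod card_bool card_ord. Qed.

Lemma twin_graph_diameter m n : 1 < m -> 0 < n -> has_diameter (twin_graph m n) 3.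
Proof.
move=> m1 n0.
have clique b (i j : 'I_n.+1) : Some (b, i) = Some (b, j) \/
    @adj (twin_graph m n) (Some (b, i)) (Some (b, j)).
  by rewrite /= eqxx; case: eqVneq => [->|]; [left | right].
have cliqueW k b (i j : 'I_n.+1) :
    @within (twin_graph m n) k.+1 (Some (b, i)) (Some (b, j)).
  exact: (@within_step (twin_graph m n) _ _ _ _ (clique b i j) (within_refl _ _)).
(* x_0 has no neighbour among the y's; x_1 has y_n, and it is adjacent to t because [1 < m]. So t
   reaches the y's through x_1 y_n. *)
pose one : 'I_n.+1 := inord 1.
have oneE : one = 1 :> nat by rewrite inordK.
have tx (i : 'I_n.+1) : i < m ->
    @adj (twin_graph m n) None (Some (false, i)) by [].
have xy b (i j : 'I_n.+1) : n < i + j ->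
    @adj (twin_graph m n) (Some (b, i)) (Some (~~ b, j)) by case: b.
split=> //; split.
  have sym (u v : vert (twin_graph m n)) : within 3 u v -> within 3 v u.
    case=> p /and3P [pP /eqP pL pS]; exists (rev (belast u p)).
    rewrite size_rev size_belast pS andbT.
    have := rev_path (@twin_adj m n) u p; rewrite pL => ->.
    rewrite (eq_path (e' := @twin_adj m n)) ?pP /=; last first.
      by move=> a b; rewrite twin_adj_sym.
    case: p pP pL pS => [|a p] /= _ <- _ //; by rewrite rev_cons last_rcons.
  have t_ok (v : vert (twin_graph m n)) : @within (twin_graph m n) 3 None v.
    case: v => [[[] j]|]; last exact: within_refl.
      apply: (within_step (G := twin_graph m n) (w := Some (false, one))).
        by right; rewrite tx ?oneE.
      apply: (within_step (G := twin_graph m n) (w := Some (true, ord_max))).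
        by right; apply: xy; rewrite oneE.
      exact: cliqueW.
    apply: (within_step (G := twin_graph m n) (w := Some (false, ord0))).
      by right; apply: tx; apply: ltnW.
    exact: cliqueW.
  case=> [[b i]|]; last exact: t_ok.
  case=> [[c j]|]; last exact/sym/t_ok.
  have [<-|nbc] := eqVneq b c; first exact: cliqueW.
  (* Between the cliques, go to the last vertex of the first one, cross along x_n y_n, and finish
     inside the second. *)
  apply: (@within_step (twin_graph m n) _ _ _ _ (clique _ _ ord_max)).
  apply: (within_step (G := twin_graph m n) (w := Some (~~ b, ord_max))).
    by right; apply: xy => /=; lia.
  have -> : c = ~~ b by case: b c nbc => [] [].
  exact: cliqueW.
(* x_0 is adjacent to no y, y_0 to no x and not to t, so they have no common neighbour. *)
exists (Some (false, ord0)), (Some (true, ord0)) => /= /within2P [//|/=|[w]].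
  by rewrite addn0.
case: w => [[[] k]|] //=; have := ltn_ord k; lia.
Qed.

Lemma twin_graph_iso m n n' : isomorphic (twin_graph m n) (twin_graph m n') -> n = n'.
Proof.
by case=> f [fB _]; have := bij_eq_card fB; rewrite !card_twin_graph; lia.
Qed.

(** * Embeddings into the twin graph *)

(** Only edges at the role placed on [x] change, and [x'] is adjacent to every used neighbour of
    [x]. *)
Lemma embeddings_swap (F G : sgraph) (f : {ffun vert F -> vert G}) (x x' : vert G) :
  f \in embeddings F G -> x' \notin codom f ->
  (forall e, adj x (f e) -> adj x' (f e)) ->
  post (tperm x x') f \in embeddings F G.
Proof.
move=> /embeddingsP [fI fE] x'f xx'.
have nx' e : f e <> x' by move=> E; case/negP: x'f; rewrite -E codom_f.
apply/embeddingsP; split; first by move=> e e'; rewrite !ffunE => /perm_inj /fI.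
move=> e e' ee'; rewrite !ffunE.
case: tpermP => [E|/nx' //|_ _]; case: tpermP => [E'|/nx' //|_ _].
- by move: (fE _ _ ee'); rewrite E E' adj_irr.
- by apply: xx'; rewrite -E fE.
- by rewrite adj_sym; apply: xx'; rewrite -E' fE // adj_sym.
- exact: fE.
Qed.

Section Counting.

Variables (F : sgraph) (B n : nat).
Hypothesis diamF : has_diameter F 2.

Let m := #|vert F|.
(** With this size, m blocks of length [B.+1] fit among x_(i+2), ..., x_n when [i <= m * B.+1], and
    among y_(n-i+1), ..., y_n when [i] is larger. *)
Hypothesis nE : n = (2 * (m * B.+1)).+1.
Let G := twin_graph m n.
Local Notation X i := (Some (false, i) : vert (twin_graph m n)).
Local Notation Y i := (Some (true, i) : vert (twin_graph m n)).
Local Notation t := (None : vert (twin_graph m n)).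

Let E := embeddings F G.
Let E0 := [set f in E | t \notin codom f].
Let E1 := through E t.

Let in_E0 f : (f \in E0) = (f \in E) && (t \notin codom f).
Proof. exact: in_set. Qed.

Let card_through_split (z : vert G) :
  #|through E z| = #|through E0 z| + #|through E1 z|.
Proof.
rewrite -(cardsID [set f : {ffun vert F -> vert G} | t \in codom f] (through E z)).
rewrite addnC.
by congr (_ + _); apply: eq_card => f;
  rewrite ?in_setD ?in_setI !in_through ?in_E0 in_set;
  case: (f \in E); case: (t \in codom f); rewrite ?andbF ?andbT.
Qed.

(** * Embeddings avoiding t: the symmetry of the cliques and the growth of D_i *)

Let flip (z : vert G) : vert G := if z is Some (b, i) then Some (~~ b, i) else None.

Let flipK : involutive flip.
Proof. by case=> [[b i]|] //=; rewrite negbK. Qed.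

Let flip_E0 (f : {ffun vert F -> vert G}) : f \in E0 -> post flip f \in E0.
Proof.
have flipI := inv_inj flipK.
rewrite in_E0 => /andP [/embeddingsP [fI fE] tf].
have tf' : t \notin codom (post flip f) by rewrite -[t]/(flip t) codom_post.
rewrite in_E0 tf' andbT; apply/embeddingsP.
split=> [e e'|e e' ee']; first by rewrite !ffunE => /flipI /fI.
have: f e != t by apply: contraNneq tf => <-; apply: codom_f.
have: f e' != t by apply: contraNneq tf => <-; apply: codom_f.
rewrite !ffunE; move: (fE _ _ ee'); case: (f e) => [[b i]|] //.
by case: (f e') => [[c j]|] //=; case: b; case: c.
Qed.

Let card_E0_flip i : #|through E0 (Y i)| = #|through E0 (X i)|.
Proof.
have flipI := inv_inj flipK.
apply/eqP; rewrite eqn_leq; apply/andP; split; apply: (card_le_post flipI) => f.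
  rewrite !in_through -[X i]/(flip (Y i)) codom_post // => /andP [fE ->].
  by rewrite flip_E0.
rewrite !in_through -[Y i]/(flip (X i)) codom_post // => /andP [fE ->].
by rewrite flip_E0.
Qed.

(** Away from t, each neighbour of x_i other than x_(i+1) is a neighbour of x_(i+1), while y_(n-i)
    is adjacent to x_(i+1) only. Embeddings using the edge y_(n-i) x_(i+1) are therefore destroyed
    by the swap. *)
Let swap_E0 (Q : {set {ffun vert F -> vert G}}) (i i' : 'I_n.+1) :
  i' = i.+1 :> nat ->
  (forall f, f \in Q -> [/\ f \in E0, X i \notin codom f &
     exists a w, [/\ adj a w, f a = Y (rev_ord i) & f w = X i']]) ->
  #|through E0 (X i)| + #|Q| <= #|through E0 (X i')|.
Proof.
move=> i'E QP; apply: card_through_swap => f.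
  rewrite in_E0 => /andP [fE tf] _ nx'.
  have -> : (post (tperm (X i) (X i')) f \in E0) =
            (post (tperm (X i) (X i')) f \in E).
    rewrite in_E0 andb_idr // => _; rewrite -[t](_ : tperm (X i) (X i') t = t).
      by rewrite codom_post //; apply: perm_inj.
    by rewrite tpermD.
  apply: embeddings_swap => // e.
  have: f e != t by apply: contraNneq tf => <-; apply: codom_f.
  have: f e != X i' by apply: contraNneq nx' => <-; apply: codom_f.
  case: (f e) => [[[] k]|] //=; first by rewrite i'E; lia.
  move=> + _ _; apply: contraNN => /eqP <-; exact: eqxx.
case/QP => fE0 nxi [a [w [aw fa fw]]]; split=> //.
  by rewrite -fw codom_f.
rewrite in_E0 negb_and; apply/orP; left; apply/embeddingsP => -[_ /(_ _ _ aw)].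
rewrite !ffunE fa fw tpermR tpermD //= subSS; have := ltn_ord i; lia.
Qed.

(** Here t and x_i pin only two roles. In any other embedding through t and x_i, the role on t has a
    further neighbour, which is confined to m vertices. *)
Let leafy (i : 'I_n.+1) : {set {ffun vert F -> vert G}} :=
  [set f in E | [exists a, exists b, [&& adj a b, [forall c, adj a c ==> (c == b)],
                                        f a == t & f b == X i]]].

Let leafyP i f : reflect (f \in E /\ exists a b,
   [/\ adj a b, forall c, adj a c -> c = b, f a = t & f b = X i]) (f \in leafy i).
Proof.
apply: (iffP setIdP) => -[fE H]; split=> //.
  case/existsP: H => a /existsP [b /and4P [ab /forallP abU /eqP fa /eqP fb]].
  by exists a, b; split=> // c /(implyP (abU c)) /eqP.
case: H => a [b [ab abU fa fb]]; apply/existsP; exists a; apply/existsP; exists b.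
by rewrite ab fa fb !eqxx !andbT; apply/forallP=> c; apply/implyP => /abU ->.
Qed.

(* Moves the edge t x_i of an embedding in [leafy i] onto x_(i+1) y_(n-i). *)
Let reroute (i i' : 'I_n.+1) (z : vert G) : vert G :=
  match z with
  | None => X i'
  | Some (false, k) => Y (tperm i (rev_ord i) k)
  | Some (true, k) => if k == i' then t else X k
  end.

(** The map permutes the vertices: y_(i+1) goes to t because x_(i+1) is taken by the image of t. *)
Let reroute_inj i i' : injective (reroute i i').
Proof.
have XI (k l : 'I_n.+1) : X k = X l -> k = l by case.
have YI (k l : 'I_n.+1) : Y k = Y l -> k = l by case.
case=> [[[] k]|] [[[] l]|] //=.
- by case: eqP => [->|_]; case: eqP => [->|_] // /XI ->.
- by case: eqP.
- by case: eqP => // kx /XI.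
- by case: eqP.
- by move=> /YI /perm_inj ->.
- by case: eqP => // kx /XI /esym.
Qed.

(** Exchanging the cliques respects i + j > n. Transposing i and n - i does no harm: for small [i],
    an index l with [n < i + l] exceeds i too, so x_l is adjacent to both y_i and y_(n-i). For such
    [i] the vertex y_(i+1) is also excluded. *)
Let reroute_adj (i i' : 'I_n.+1) (z z' : vert G) : i' = i.+1 :> nat ->
  i <= m * B.+1 -> z != t -> z' != t ->
  (forall k, z = Y k -> n < i + k) -> (forall k, z' = Y k -> n < i + k) ->
  adj z z' -> adj (reroute i i' z) (reroute i i' z').
Proof.
move=> i'E il.
have yNi' (k : 'I_n.+1) : n < i + k -> (k == i') = false.
  move=> ki; apply/negP => /eqP kE; move: ki; rewrite kE i'E; lia.
have xy (k l : 'I_n.+1) : n < i + l -> n < k + l -> n < tperm i (rev_ord i) k + l.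
  have := ltn_ord i; case: tpermP => [->|->|//] /=; lia.
case: z z' => [[[] k]|] [[[] l]|] //= _ _ zk zl.
- by rewrite (yNi' k) ?(yNi' l) //; [exact: zl | exact: zk].
- rewrite (yNi' k) => [kl|]; last exact: zk.
  by rewrite /= addnC; apply: xy; [exact: zk | rewrite addnC].
- rewrite (yNi' l) => [kl|]; last exact: zl.
  by apply: xy => //; exact: zl.
- by rewrite (inj_eq perm_inj).
Qed.

Let diam_cases (e e' : vert F) :
  [\/ e = e', adj e e' | exists2 c, adj e c & adj c e'].
Proof. by apply: within2P; case: diamF => _ []. Qed.

Let reroute_leafy (i i' : 'I_n.+1) f : i' = i.+1 :> nat -> i <= m * B.+1 ->
  f \in leafy i ->
  [/\ post (reroute i i') f \in E0, X i \notin codom (post (reroute i i') f) &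
     exists a b, [/\ adj a b, forall c, adj b c -> c = a,
       post (reroute i i') f a = Y (rev_ord i) & post (reroute i i') f b = X i']].
Proof.
move=> i'E il /leafyP [/embeddingsP [fI fE] [a [b [ab abU fa fb]]]].
have ii' : i != i' by apply/eqP => ii; move: i'E; rewrite -ii; lia.
(* In diameter 2 the neighbour [b] of a leaf is adjacent to every other role. Hence only y_k with k
   > n - i occur, which excludes y_(i+1) and y_i, the vertices sent to t and x_i. *)
have around e : [\/ e = a, e = b | adj (X i) (f e)].
  case: (diam_cases a e) => [->|/abU ->|[c /abU -> be]]; first by constructor 1.
    by constructor 2.
  by constructor 3; rewrite -fb; apply: fE.
have ylow e k : f e = Y k -> n < i + k.
  by case: (around e) => [->|->|]; rewrite ?fa ?fb // => + fk; rewrite fk.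
have iS := ltn_ord i.
split.
- rewrite in_E0; apply/andP; split; last first.
    apply/codomP => -[e]; rewrite ffunE.
    case fe: (f e) => [[[] k]|] //=; case: eqP => // kE _.
    by have := ylow _ _ fe; rewrite kE i'E; lia.
  apply/embeddingsP; split=> [e e'|].
    by rewrite !ffunE => /reroute_inj /fI.
  have Nt e : e != a -> f e != t by apply: contra_neq => fe; apply: fI; rewrite fe fa.
  have abR : adj (reroute i i' (f a)) (reroute i i' (f b)).
    by rewrite fa fb /= tpermL /= subSS i'E; lia.
  move=> e e' ee'; rewrite !ffunE.
  have [ea|na] := eqVneq e a.
    by rewrite ea in ee' *; rewrite (abU _ ee').
  have [ea'|na'] := eqVneq e' a.
    by rewrite ea' in ee' *; rewrite adj_sym in ee'; rewrite (abU _ ee') adj_sym.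
  apply: reroute_adj => //; try exact: Nt; try exact: ylow; exact: fE.
- apply/codomP => -[e]; rewrite ffunE.
  case fe: (f e) => [[[] k]|] //=; last by case=> /eqP; rewrite (negPf ii').
  case: eqP => // _ [kE]; have := ylow _ _ fe; rewrite -kE; lia.
- exists b, a; split; rewrite ?ffunE ?fa ?fb //=; last by rewrite tpermL.
  by rewrite adj_sym.
Qed.

Let pin (v u : vert F) (i i' : 'I_n.+1) (e : vert F) : option (vert G) :=
  if e == v then Some (Y (rev_ord i)) else if e == u then Some (X i') else None.

Let block (b : bool) (c s : nat) : vert G := Some (b, inord (c + s)).

Let block_val b c s : c + m * B.+1 <= n.+1 -> s < m * B.+1 ->
  exists2 l : 'I_n.+1, block b c s = Some (b, l) & l = c + s :> nat.
Proof. by move=> cm sm; exists (inord (c + s)); rewrite ?inordK //; lia. Qed.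

Let block_base_inj b c k l : c + m * B.+1 <= n.+1 -> k < m * B.+1 -> l < m * B.+1 ->
  block b c k = block b c l -> k = l.
Proof.
move=> cm km lm; have [k' -> kE] := block_val b cm km.
have [l' -> lE] := block_val b cm lm; case=> kl; move: kE lE; rewrite kl; lia.
Qed.

(** The image is a clique, made of the edge y_(n-i) x_(i+1) and vertices adjacent to both ends, so
    every edge of [F] is respected. *)
Let place_block (v u : vert F) (i i' : 'I_n.+1) (b : bool) (c : nat)
    (g : {ffun vert F -> 'I_B.+1}) :
  let f := place (pin v u i i') (block b c) g in
  v != u -> i' = i.+1 :> nat -> c + m * B.+1 <= n.+1 ->
  (forall l : 'I_n.+1, c <= l -> [/\ adj (Y (rev_ord i)) (Some (b, l)),
      adj (X i') (Some (b, l)) & X i != Some (b, l)]) ->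
  [/\ f \in E0, X i \notin codom f, f v = Y (rev_ord i) & f u = X i'].
Proof.
move=> f vu i'E cm cP.
have fv : f v = Y (rev_ord i) by rewrite ffunE /pin eqxx.
have fu : f u = X i' by rewrite ffunE /pin [u == v]eq_sym (negPf vu) eqxx.
have fo e : e != v -> e != u -> exists2 l : 'I_n.+1, f e = Some (b, l) &
    l = c + (enum_rank e * B.+1 + g e) :> nat.
  move=> ev eu; rewrite ffunE /pin (negPf ev) (negPf eu).
  exact: block_val (block_lt _ _).
have vuE : adj (Y (rev_ord i)) (X i').
  by rewrite /= subSS i'E; have := ltn_ord i; lia.
have adjf e e' : e != e' -> adj (f e) (f e').
  have [->|ev] := eqVneq e v; have [->|ev'] := eqVneq e' v => //.
  - have [->|eu'] := eqVneq e' u; first by rewrite fu fv.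
    have [l -> lE] := fo _ ev' eu' => _; rewrite fv; case: (cP l) => //; lia.
  - have [->|eu] := eqVneq e u; first by rewrite fu fv adj_sym.
    have [l -> lE] := fo _ ev eu => _; rewrite fv adj_sym; case: (cP l) => //; lia.
  have [->|eu] := eqVneq e u; have [->|eu'] := eqVneq e' u => //.
  - have [l -> lE] := fo _ ev' eu' => _; rewrite fu; case: (cP l) => //; lia.
  - have [l -> lE] := fo _ ev eu => _; rewrite fu adj_sym; case: (cP l) => //; lia.
  have [l -> lE] := fo _ ev eu; have [l' -> lE'] := fo _ ev' eu' => ne.
  rewrite /= eqxx; apply: contra_neq ne => ll; rewrite ll lE' in lE.
  by case: (block_inj (addnI lE)).
have out z : z <> Y (rev_ord i) -> z <> X i' ->
    (forall l : 'I_n.+1, c <= l -> z <> Some (b, l)) ->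
    z \notin codom f.
  move=> z1 z2 z3; apply/codomP => -[e].
  have [->|ev] := eqVneq e v; first by rewrite fv.
  have [->|eu] := eqVneq e u; first by rewrite fu.
  by have [l -> lE] := fo _ ev eu; apply: z3; lia.
split=> //.
  rewrite in_E0 out // andbT; apply/embeddingsP; split=> [e e' ff|e e' ee'].
    by apply: contraTeq isT => /adjf; rewrite ff adj_irr.
  exact/adjf/adj_neq.
apply: out => // [[/(congr1 val) /= ii]|l cl /eqP E1E].
  by move: i'E ii; lia.
by case: (cP l cl) => _ _; rewrite E1E.
Qed.

Let card_pin (v u : vert F) (i i' : 'I_n.+1) : v != u ->
  #|[set e | ~~ pin v u i i' e]| = m - 2.
Proof.
move=> vu; have -> : [set e | ~~ pin v u i i' e] = ~: [set v; u].
  by apply/setP=> e; rewrite !inE /pin; case: (e == v); case: (e == u).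
by have := cardsC [set v; u]; rewrite cards2 vu /m; lia.
Qed.

Let card_leafy_out (i : 'I_n.+1) : m <= i -> leafy i = set0.
Proof.
move=> mi; apply/setP=> f; rewrite in_set0; apply/negP => /leafyP [/embeddingsP].
by case=> _ fE [a [b [ab _ fa fb]]]; have := fE _ _ ab; rewrite fa fb /=; lia.
Qed.

(** Two disjoint families use the edge y_(n-i) x_(i+1) and avoid t and x_i: the rerouted members of
    [leafy i], and the cliques of [place_block]. *)
Let gap (i i' : 'I_n.+1) : i' = i.+1 :> nat ->
  #|through E0 (X i)| + (#|leafy i| + B.+1 ^ (m - 2)) <= #|through E0 (X i')|.
Proof.
move=> i'E; have [v [u [w [vw _ vu uw]]]] := diameter2_cherry diamF.
have iS := ltn_ord i; have iS' := ltn_ord i'; have nvu := adj_neq vu.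
have [il|il] := leqP i (m * B.+1).
  (* From index i + 2 on, the x's are adjacent to y_(n-i) and differ from x_i and x_(i+1). *)
  have cm : i.+2 + m * B.+1 <= n.+1 by lia.
  pose P := [set place (pin v u i i') (block false i.+2) g |
               g in [set: {ffun vert F -> 'I_B.+1}]].
  have PP f : f \in P ->
      [/\ f \in E0, X i \notin codom f, f v = Y (rev_ord i) & f u = X i'].
    case/imsetP => g _ ->; apply: place_block => // l cl /=; split.
    - by lia.
    - by apply/eqP => E'; move: cl; rewrite -E' i'E; lia.
    - by apply/eqP => -[E']; move: cl; rewrite -E'; lia.
  pose M := post (reroute i i') @: leafy i.
  rewrite -(card_imset (leafy i) (post_inj (S := vert F) (@reroute_inj i i'))) -/M.
  apply: (@leq_trans (#|through E0 (X i)| + #|M :|: P|)); last first.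
    apply: swap_E0 => // f; rewrite in_setU => /orP [/imsetP [f0 f0l ->]|/PP].
      have [fE nX [a [b [ab _ fa fb]]]] := reroute_leafy i'E il f0l.
      by split=> //; exists a, b.
    by case=> fE nX fv fu; split=> //; exists v, u.
  (* The role on x_(i+1) is a leaf in [M], but in [P] it is [u], with the two neighbours [v] and
     [w]. *)
  have MP0 : M :&: P = set0.
    apply/setP=> f; rewrite in_setI in_set0; apply/negP => /andP [/imsetP [f0 f0l ->]].
    case/PP => fE _ fv fu.
    have [_ _ [a [b [_ bU _ fb]]]] := reroute_leafy i'E il f0l.
    move: fE; rewrite in_E0 => /andP [/embeddingsP [fI _] _].
    have bu : b = u by apply: fI; rewrite fb fu.
    by rewrite adj_sym in vu; rewrite bu in bU; rewrite (bU _ vu) (bU _ uw) eqxx in vw.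
  have := cardsUI M P; rewrite MP0 cards0 addn0 => ->.
  rewrite !leq_add2l -(card_pin i i' nvu).
  apply: (card_place (base := block false i.+2)).
    by move=> k l; apply: block_base_inj.
  by move=> g; apply: imset_f.
(* Now i exceeds m, so t is not adjacent to x_i; the free roles go to the y's beyond y_(n-i), all
   adjacent to x_(i+1). *)
rewrite card_leafy_out ?cards0 ?add0n; last by nia.
have cm : (n - i).+1 + m * B.+1 <= n.+1 by lia.
pose P := [set place (pin v u i i') (block true (n - i).+1) g |
             g in [set: {ffun vert F -> 'I_B.+1}]].
apply: (@leq_trans (#|through E0 (X i)| + #|P|)); last first.
  apply: swap_E0 => // f /imsetP [g _ ->].
  have [] := @place_block v u i i' true (n - i).+1 g => //.
    move=> l cl; split=> //=; last by lia.
    by apply/eqP => E'; move: cl; rewrite -E' /=; lia.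
  by move=> fE nX fv fu; split=> //; exists v, u.
rewrite leq_add2l -(card_pin i i' nvu).
apply: (card_place (base := block true (n - i).+1)).
  by move=> k l; apply: block_base_inj.
by move=> g; apply: imset_f.
Qed.

(** * Embeddings through t: upper bounds and the strict inequality B_i < A_i *)

Let N := #|vert G|.

Let card_pinned (D : {set vert F}) (p : vert F -> vert G) :
  #|[set f : {ffun vert F -> vert G} | [forall e in D, f e == p e]]| = N ^ (m - #|D|).
Proof. by rewrite card_ffun_fixed; congr (_ ^ _); have := cardsC D; rewrite /m; lia. Qed.

(** Indexing by ['I_m] makes the choice of this image cost a factor m instead of n. *)
Let t_neighbour (f : {ffun vert F -> vert G}) a c : f \in E -> f a = t -> adj a c ->
  exists2 s : 'I_m, (s : nat) <= n & f c = X (inord s).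
Proof.
move=> /embeddingsP [_ fE] fa /fE; rewrite fa; case: (f c) => [[[] k]|] //= km.
by exists (Ordinal km); rewrite /= ?inord_val //; apply: (ltn_ord k).
Qed.

Let exists_neighbour (a b : vert F) : a != b -> exists c, adj a c.
Proof.
move=> /eqP ab; case: (diam_cases a b) => [/ab//|?|[c ac _]]; first by exists b.
by exists c.
Qed.

(** The role [a] on t, a neighbour [c] of it and the image of [c] give m choices each and pin two
    roles. *)
Let card_E1 : #|E1| <= m ^ 3 * N ^ (m - 2).
Proof.
pose pt a (s : 'I_m) (e : vert F) : vert G := if e == a then t else X (inord s).
pose C (q : vert F * vert F * 'I_m) : {set {ffun vert F -> vert G}} :=
  if q.1.1 != q.1.2 then
    [set f : {ffun vert F -> vert G} |
       [forall e in [set q.1.1; q.1.2], f e == pt q.1.1 q.2 e]]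
  else set0.
have cI : #|{: vert F * vert F * 'I_m}| = m ^ 3.
  by rewrite !card_prod card_ord -/m !expnS expn0; lia.
rewrite -cI; apply: (card_le_cover (C := C)) => [f|[[a c] s]]; last first.
  rewrite /C /=; case: ifP => [ac|_]; last by rewrite cards0.
  by rewrite card_pinned cards2 ac.
rewrite in_through => /andP [fE /codomP [a /esym fa]].
have [v [u [w [vw _ _ _]]]] := diameter2_cherry diamF.
have [c ac] : exists c, adj a c.
  have [av|] := eqVneq a v; last exact: exists_neighbour.
  by rewrite av; apply: exists_neighbour vw.
have [s _ fc] := t_neighbour fE fa ac; exists (a, c, s).
rewrite /C /= (adj_neq ac) inE; apply/forall_inP=> e.
rewrite !inE /pt => /orP [] /eqP ->; first by rewrite eqxx fa.
by rewrite [c == a]eq_sym (negPf (adj_neq ac)) fc.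
Qed.

(** Outside [leafy i], the role on t has a neighbour [c] other than the role on x_i, so three roles
    are pinned. *)
Let card_E1_X (i : 'I_n.+1) :
  #|through E1 (X i)| <= #|leafy i| + m ^ 4 * N ^ (m - 3).
Proof.
pose pt a b (s : 'I_m) (e : vert F) : vert G :=
  if e == a then t else if e == b then X i else X (inord s).
pose C (q : vert F * vert F * vert F * 'I_m) : {set {ffun vert F -> vert G}} :=
  let: (a, b, c, s) := q in
  if [&& a != b, a != c & b != c] then
    [set f : {ffun vert F -> vert G} |
       [forall e in c |: [set a; b], f e == pt a b s e]]
  else set0.
have cI : #|{: vert F * vert F * vert F * 'I_m}| = m ^ 4.
  by rewrite !card_prod card_ord -/m !expnS expn0; lia.
rewrite -(cardsID (leafy i)) leq_add ?subset_leq_card ?subsetIr //.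
rewrite -cI; apply: (card_le_cover (C := C)) => [f|[[[a b] c] s]]; last first.
  rewrite /C /=; case: ifP => [/and3P [ab ac bc]|_]; last by rewrite cards0.
  rewrite card_pinned cardsU1 cards2 ab !inE negb_or.
  by rewrite [c == a]eq_sym [c == b]eq_sym ac bc.
rewrite in_setD !in_through => /andP [nl /andP [/andP [fE /codomP [a /esym fa]]]].
move=> /codomP [b /esym fb].
have ab : a != b by apply: contraTneq isT => ab; rewrite ab fb in fa.
have [c ac cb] : exists2 c, adj a c & c != b.
  have [/existsP [c /andP [ac cb]]|none] := boolP [exists c, adj a c && (c != b)].
    by exists c.
  have abU c : adj a c -> c = b.
    move=> ac; apply/eqP; apply: contraNT none => cb.
    by apply/existsP; exists c; rewrite ac.
  case/negP: nl; apply/leafyP; split=> //; exists a, b; split=> //.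
  by have [c ac] := exists_neighbour ab; rewrite -(abU c ac).
have [s _ fc] := t_neighbour fE fa ac; exists (a, b, c, s).
rewrite /C /= ab (adj_neq ac) [b == c]eq_sym cb inE; apply/forall_inP=> e.
rewrite !inE /pt => /or3P [] /eqP ->; first last.
- by rewrite [b == a]eq_sym (negPf ab) eqxx fb.
- by rewrite eqxx fa.
- by rewrite [c == a]eq_sym (negPf (adj_neq ac)) (negPf cb) fc.
Qed.

(* This is where the diameter of [F] confines the embeddings through t. *)
Let E1_Y (f : {ffun vert F -> vert G}) e (j : 'I_n.+1) :
  f \in E1 -> f e = Y j -> n.+1 < j + m.
Proof.
rewrite in_through => /andP [fE /codomP [a /esym fa]] fe.
case: (diam_cases a e) => [ae|ae|[c ac ce]].
- by rewrite -ae fa in fe.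
- by move/embeddingsP: fE => [_ /(_ _ _ ae)]; rewrite fa fe.
- have [s sn fc] := t_neighbour fE fa ac.
  move/embeddingsP: fE => [_ /(_ _ _ ce)]; rewrite fc fe /= inordK //.
  by have := ltn_ord s; lia.
Qed.

(** For a path v u w with v, w nonadjacent, v goes to t, w to x_i, u to x_0 if i > 0, and the rest
    to early x's. As w is not adjacent to v, the index i may be large. The edge x_0 x_i later gives
    strictness. *)
Let witness (i : 'I_n.+1) : exists2 f : {ffun vert F -> vert G},
  f \in through E1 (X i) & (forall j, Y j \notin codom f) /\
  (i != ord0 -> exists u w, [/\ adj u w, f u = X ord0 & f w = X i]).
Proof.
have [v [u [w [vw nvw vu uw]]]] := diameter2_cherry diamF.
have m0 : 0 < m by apply/card_gt0P; exists v.
have mn : m <= n.+1 by nia.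
pose r e := tperm (enum_rank u) (Ordinal m0) (enum_rank e).
have rI : injective r by move=> e e' /perm_inj /enum_rank_inj.
have ru : r u = 0 :> nat by rewrite /r tpermL.
(* The slot of [w] is free since [w] goes to x_i; it is given to the role whose own slot is i. *)
pose pos e : 'I_n.+1 := inord (if r e == i :> nat then r w else r e).
have posE e : pos e = (if r e == i :> nat then r w else r e) :> nat.
  by rewrite inordK //; case: ifP => _; apply: leq_trans (ltn_ord _) mn.
have posm e : pos e < m by rewrite posE; case: ifP.
have posi e : e != w -> pos e != i.
  move=> ew; rewrite -val_eqE /= posE; case: ifP => [/eqP rei|->//].
  by apply: contra_neq ew => rwi; apply/rI/val_inj; rewrite /= rei rwi.
have posI e e' : e != w -> e' != w -> pos e = pos e' -> e = e'.
  move=> ew ew' /(congr1 val); rewrite /= !posE.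
  have Nw e1 : e1 != w -> r w <> r e1 :> nat.
    by move=> /eqP e1w /val_inj /rI /esym.
  case: ifP => [/eqP rei|_]; case: ifP => [/eqP rei'|_].
  - by move=> _; apply/rI/val_inj; rewrite /= rei rei'.
  - by move/Nw => /(_ ew').
  - by move/esym/Nw => /(_ ew).
  - by move/val_inj/rI.
pose f : {ffun vert F -> vert G} :=
  [ffun e => if e == v then t else if e == w then X i else X (pos e)].
have fv : f v = t by rewrite ffunE eqxx.
have fw : f w = X i by rewrite ffunE eq_sym (negPf vw) eqxx.
have fo e : e != v -> e != w -> f e = X (pos e).
  by rewrite ffunE => /negPf -> /negPf ->.
have XI (k l : 'I_n.+1) : X k = X l -> k = l by case.
have fI : injective f.
  move=> e e'; have [->|ev] := eqVneq e v; have [->|ev'] := eqVneq e' v => //.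
  - by rewrite fv ffunE (negPf ev'); case: ifP.
  - by rewrite fv ffunE (negPf ev); case: ifP.
  have [->|ew] := eqVneq e w; have [->|ew'] := eqVneq e' w => //.
  - by rewrite fw fo // => /XI E'; have := posi _ ew'; rewrite -E' eqxx.
  - by rewrite fw fo // => /XI E'; have := posi _ ew; rewrite E' eqxx.
  - by rewrite !fo // => /XI; apply: posI.
have fX e : e != v -> exists k, f e = X k.
  by move=> ev; rewrite ffunE (negPf ev); case: ifP => _; [exists i | exists (pos e)].
have fE e e' : adj e e' -> adj (f e) (f e').
  have tcase x : adj v x -> adj (f v) (f x).
    move=> vx; rewrite fv fo ?posm //=; first by rewrite eq_sym adj_neq.
    by apply: contraNneq nvw => <-.
  have [->|ev] := eqVneq e v; first exact: tcase.
  have [->|ev'] := eqVneq e' v.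
    by rewrite ![adj _ v]adj_sym [adj _ (f v)]adj_sym; apply: tcase.
  move=> ee'; have [k fk] := fX _ ev; have [l fl] := fX _ ev'.
  rewrite fk fl /=; apply: contra_neq (adj_neq ee') => kl.
  by apply: fI; rewrite fk fl kl.
have uv : u != v by rewrite eq_sym adj_neq.
exists f; last split.
- rewrite !in_through -{1}fv -fw !codom_f !andbT; exact/embeddingsP.
- move=> j; apply/codomP => -[e]; have [->|/fX [k ->]//] := eqVneq e v.
  by rewrite fv.
- move=> i0; exists u, w; split=> //; rewrite fo ?(adj_neq uw) //; congr (Some (_, _)).
  apply: val_inj; rewrite /= posE ru eq_sym.
  by move: i0; rewrite -val_eqE /= => /negPf ->.
Qed.

(** If y_i is out of reach, [witness] suffices. Otherwise y_i can be replaced by x_i in embeddings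
    through t, and the edge x_0 x_i of the witness cannot be moved back to y_i. *)
Let card_E1_lt (i : 'I_n.+1) : #|through E1 (Y i)| < #|through E1 (X i)|.
Proof.
have [f fX [fY f0]] := witness i.
have [im|im] := leqP (i + m) n.+1.
  have -> : through E1 (Y i) = set0.
    apply/setP=> g; rewrite in_set0 in_through.
    apply/negP => /andP [gE /codomP [e /esym ge]].
    by have := E1_Y gE ge; lia.
  by rewrite cards0; apply/card_gt0P; exists f.
have m0 : 0 < m by case: diamF => _ [_ [v _]]; apply/card_gt0P; exists v.
have [u [w [uw fu fw]]] : exists u w, [/\ adj u w, f u = X ord0 & f w = X i].
  by apply: f0; apply: contraTneq im => ->; rewrite /= -leqNgt; nia.
rewrite -addn1 -(cards1 f); apply: card_through_swap => g; last first.
  rewrite in_set1 => /eqP ->; move: fX; rewrite in_through => /andP [fE1 fXi].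
  split=> //.
  rewrite in_through; apply/nandP; left.
  apply/embeddingsP => -[_ /(_ _ _ uw)]; rewrite !ffunE fu fw tpermR tpermD //=.
    by rewrite add0n; have := ltn_ord i; lia.
  by apply: contraTneq im => -[->]; rewrite /= -leqNgt; nia.
move=> gE1; have := gE1; rewrite in_through => /andP [gE gt] gY gX.
rewrite in_through; apply/andP; split; last first.
  by have := codom_post g t (@perm_inj _ (tperm (Y i) (X i))); rewrite tpermD // => ->.
apply: embeddings_swap => // e.
have: g e != X i by apply: contraNneq gX => <-; apply: codom_f.
case ge: (g e) => [[[] k]|] //=.
  (* Both i and k exceed n + 1 - m, so i + k > n. *)
  by have := E1_Y gE1 ge; nia.
by move=> + _; apply: contraNN => /eqP ->.
Qed.

(** * Comparison of the counts at all vertices *)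

Let card_E0_ord0 : B.+1 ^ (m - 1) <= #|through E0 (X ord0)|.
Proof.
have [v _] : exists v : vert F, True by case: diamF => _ [_ [v _]]; exists v.
pose p (e : vert F) : option (vert G) := if e == v then Some (X ord0) else None.
have -> : m - 1 = #|[set e | ~~ p e]|.
  have -> : [set e | ~~ p e] = ~: [set v] by apply/setP=> e; rewrite !inE /p; case: ifP.
  by have := cardsC [set v]; rewrite cards1 /m; lia.
have cm : 1 + m * B.+1 <= n.+1 by lia.
apply: (card_place (base := block false 1)) => [k l|g].
  exact: block_base_inj.
set f := place _ _ _; have fv : f v = X ord0 by rewrite ffunE /p eqxx.
have fo e : e != v -> exists2 l : 'I_n.+1, f e = X l &
    l = 1 + (enum_rank e * B.+1 + g e) :> nat.
  by move=> ev; rewrite ffunE /p (negPf ev); apply: block_val (block_lt _ _).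
have fX e : exists l : 'I_n.+1, f e = X l.
  by have [->|/fo [l ->]] := eqVneq e v; [exists ord0 | exists l].
have fI : injective f.
  move=> e e'; have [->|ev] := eqVneq e v; have [->|ev'] := eqVneq e' v => //.
  - by have [l -> lE] := fo _ ev'; rewrite fv => -[l0]; by move: lE; rewrite -l0.
  - by have [l -> lE] := fo _ ev; rewrite fv => -[l0]; by move: lE; rewrite l0.
  have [l -> lE] := fo _ ev; have [l' -> lE'] := fo _ ev' => -[ll'].
  by rewrite ll' lE' in lE; case: (block_inj (addnI lE)).
rewrite in_through -fv codom_f andbT in_E0; apply/andP; split; last first.
  by apply/codomP => -[e]; have [l ->] := fX e.
apply/embeddingsP; split=> // e e' /adj_neq ee'.
have [l fl] := fX e; have [l' fl'] := fX e'; rewrite fl fl' /=.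
by apply: contra_neq ee' => ll'; apply: fI; rewrite fl fl' ll'.
Qed.

(** The first inequality makes the clique term of [gap] beat the part of A_i outside [leafy i]; the
    second puts the count at t below D_0. *)
Lemma twin_graph_irregular :
  m ^ 4 * N ^ (m - 3) < B.+1 ^ (m - 2) -> m ^ 3 * N ^ (m - 2) < B.+1 ^ (m - 1) ->
  F_irregular F G.
Proof.
move=> small3 small2; apply: F_irregular_embeddings.
pose D (i : 'I_n.+1) := #|through E0 (X i)|.
pose A (i : 'I_n.+1) := #|through E1 (X i)|.
have step (i i' : 'I_n.+1) : i' = i.+1 :> nat -> D i + A i < D i'.
  move=> /gap; have := card_E1_X i; rewrite -/(D i) -/(A i) -/(D i'); lia.
have mono (i j : 'I_n.+1) : i < j -> D i + A i < D j.
  move: {2}(j : nat) (erefl (j : nat)) => k; elim: k j => [|k IH] j jk ij; first by lia.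
  have kn : k < n.+1 by have := ltn_ord j; lia.
  have kj : D (Ordinal kn) + A (Ordinal kn) < D j by apply: step.
  have [ik|ki] := ltnP i k; first by have := IH (Ordinal kn) erefl ik; lia.
  by have -> : i = Ordinal kn by apply: val_inj; rewrite /=; lia.
have lowD i : #|E1| < D i.
  have D0 : #|E1| < D ord0.
    by apply: leq_ltn_trans card_E1 _; apply: leq_trans small2 card_E0_ord0.
  have [->//|i0] := eqVneq i ord0.
  have := mono ord0 i; rewrite lt0n => /(_ i0); lia.
(* Every count off t is D_i + r with r at most A_i: the size determines i, and equality tells x_i
   from y_i. *)
have xyE (z : vert G) : z <> t -> exists b i r,
    [/\ z = Some (b, i), #|through E z| = D i + r,
        r <= A i & (r == A i) = ~~ b].
  case: z => [[b i]|] // _; exists b, i, #|through E1 (Some (b, i))|.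
  rewrite card_through_split; case: b; split=> //; rewrite ?card_E0_flip //=.
  + exact/ltnW/card_E1_lt.
  + by apply/negbTE; rewrite neq_ltn card_E1_lt.
  + by rewrite eqxx.
have tE : #|through E t| = #|E1| by [].
move=> z z' /=; rewrite -/E.
have [->|/eqP/xyE [b [i [r [-> -> rA rb]]]]] := eqVneq z t;
  have [->|/eqP/xyE [c [j [s [-> -> sA sc]]]]] := eqVneq z' t => //.
- by rewrite tE; have := lowD j; lia.
- by rewrite tE; have := lowD i; lia.
move=> EE; have [ij|ji|/val_inj ij] := ltngtP i j.
- by have := mono _ _ ij; lia.
- by have := mono _ _ ji; lia.
move: EE sA sc; rewrite -ij => /addnI <- _; rewrite rb => bc.
by congr (Some (_, _)); apply: negb_inj.
Qed.

End Counting.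

(** * Choice of the parameters *)

Theorem theorem4 (F : sgraph) :
  nontrivial F -> has_diameter F 2 ->
  exists G : nat -> sgraph,
    (forall n, nontrivial (G n) /\ has_diameter (G n) 3 /\ F_irregular F (G n)) /\
    (forall m n, m <> n -> ~ isomorphic (G m) (G n)).
Proof.
move=> _ diamF; set m := #|vert F|.
have m3 : 2 < m.
  have [v [u [w [vw nvw vu uw]]]] := diameter2_cherry diamF.
  have <- : #|u |: [set v; w]| = 3.
    by rewrite cardsU1 cards2 vw !inE negb_or (adj_neq uw) eq_sym (adj_neq vu).
  exact: max_card.
(* The graph has at most 9m(b + 1) vertices, so m^e N^r is at most m^4 (9m)^m (b + 1)^r, below (b +
   1)^(r+1). The summand [k] makes the orders distinct. *)
pose b k := m ^ 4 * (9 * m) ^ m + k.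
pose n k := (2 * (m * (b k).+1)).+1.
exists (fun k => twin_graph m (n k)); split=> [k|k l kl /twin_graph_iso]; last first.
  by rewrite /n /b; nia.
split; first by rewrite /nontrivial card_twin_graph.
split; first by apply: twin_graph_diameter => //; apply: ltnW.
have card_le : #|vert (twin_graph m (n k))| <= 9 * m * (b k).+1.
  by rewrite card_twin_graph /n; nia.
have bound e r : e <= 4 -> r <= m ->
    m ^ e * #|vert (twin_graph m (n k))| ^ r < (b k).+1 ^ r.+1.
  move=> e4 rm; rewrite expnS; apply: (@leq_ltn_trans (b k * (b k).+1 ^ r)).
    apply: (@leq_trans (m ^ e * (9 * m * (b k).+1) ^ r)).
      by case: (posnP r) => [->|r0];
        rewrite ?expn0 // leq_mul2l leq_exp2r ?card_le ?orbT.
    rewrite expnMn mulnA leq_mul2r; apply/orP; right; apply: leq_trans (leq_addr _ _).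
    by rewrite leq_mul // leq_pexp2l //; lia.
  by rewrite ltn_mul2r expn_gt0 /= ltnSn.
apply: (@twin_graph_irregular F (b k) (n k)) => //; rewrite -/m.
- by rewrite -[m - 2](_ : (m - 3).+1 = _) ?bound //; lia.
- by rewrite -[m - 1](_ : (m - 2).+1 = _) ?bound //; lia.
Qed.
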